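(* The local complexity of the class of triangle-free unit-square graphs is $\Theta(n)$, and the local complexity of the class of unit-square graphs is $\Omega(n)$ and $O(n\log n)$.
   Context: A unit-square graph is the graph on a finite point set in the plane with two points adjacent iff their $\ell_\infty$-distance is at most 1. All graphs are finite, simple, connected; $n$ is the number of vertices, with distinct identifiers in $\{1,\dots,\mathrm{poly}(n)\}$. A proof labeling scheme for a class $\mathcal{G}$ consists of a prover assigning a certificate (binary word) to each vertex of each $G\in\mathcal{G}$ and a local verifier where each vertex accepts or rejects based only on identifiers and certificates in its closed neighborhood; all vertices accept when $G\in\mathcal{G}$ with the prover's certificates, and when $G\notin\mathcal{G}$ some vertex rejects for every certificate assignment. The local complexity of $\mathcal{G}$ is the minimum, over such schemes, of the maximum certificate length used on $n$-vertex graphs of $\mathcal{G}$. *)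

(* Defs.v *)
From mathcomp Require Import all_boot.
From Stdlib Require Import Reals.
Set Implicit Arguments. Unset Strict Implicit. Unset Printing Implicit Defensive.

Definition simple_connected (n : nat) (adj : rel 'I_n) : Prop :=
  symmetric adj /\ irreflexive adj /\ (forall u v : 'I_n, connect adj u v).

Definition unit_square (n : nat) (adj : rel 'I_n) : Prop :=
  exists p : 'I_n -> (R * R)%type,
    injective p /\
    forall u v : 'I_n, u != v ->
      (adj u v <-> (Rmax (Rabs (fst (p u) - fst (p v)))
                         (Rabs (snd (p u) - snd (p v))) <= 1)%R).

Definition triangle_free (n : nat) (adj : rel 'I_n) : Prop :=
  forall u v w : 'I_n, ~ (adj u v /\ adj v w /\ adj u w).

Definition usg_class (n : nat) (adj : rel 'I_n) : Prop := unit_square adj.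
Definition tf_usg_class (n : nat) (adj : rel 'I_n) : Prop :=
  unit_square adj /\ triangle_free adj.

Definition valid_ids (c n : nat) (id : 'I_n -> nat) : Prop :=
  injective id /\ forall v, 1 <= id v <= n ^ c.

Definition view_nbrs (n : nat) (adj : rel 'I_n) (id : 'I_n -> nat)
    (cert : 'I_n -> seq bool) (v : 'I_n) : nat -> option (seq bool) :=
  fun k => match [pick u | adj v u && (id u == k)] with
           | Some u => Some (cert u)
           | None => None
           end.

Definition prover_t := forall n : nat, rel 'I_n -> ('I_n -> nat) -> 'I_n -> seq bool.
Definition verifier_t := nat -> seq bool -> (nat -> option (seq bool)) -> bool.

Definition accepts (V : verifier_t) (n : nat) (adj : rel 'I_n) (id : 'I_n -> nat)
    (cert : 'I_n -> seq bool) (v : 'I_n) : bool :=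
  V (id v) (cert v) (view_nbrs adj id cert v).

Definition pls (cls : forall n, rel 'I_n -> Prop) (c : nat)
    (P : prover_t) (V : verifier_t) : Prop :=
  (forall n (adj : rel 'I_n) (id : 'I_n -> nat),
      simple_connected adj -> valid_ids c id -> cls n adj ->
      forall v, accepts V adj id (P n adj id) v)
  /\
  (forall n (adj : rel 'I_n) (id : 'I_n -> nat) (cert : 'I_n -> seq bool),
      simple_connected adj -> valid_ids c id -> ~ cls n adj ->
      exists v, accepts V adj id cert v = false).

Definition lc_bigO (cls : forall n, rel 'I_n -> Prop) (c : nat) (f : nat -> nat) : Prop :=
  exists K (P : prover_t) (V : verifier_t), pls cls c P V /\
    forall n (adj : rel 'I_n) (id : 'I_n -> nat) (v : 'I_n),
      simple_connected adj -> valid_ids c id -> cls n adj ->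
      size (P n adj id v) <= K * (f n).+1.

Definition lc_bigOmega (cls : forall n, rel 'I_n -> Prop) (c : nat) (f : nat -> nat) : Prop :=
  exists K N, 0 < K /\
    forall (P : prover_t) (V : verifier_t), pls cls c P V ->
    forall n, N <= n ->
      exists (adj : rel 'I_n) (id : 'I_n -> nat) (v : 'I_n),
        simple_connected adj /\ valid_ids c id /\ cls n adj /\
        f n <= K * size (P n adj id v).

Definition nlogn (n : nat) : nat := n * trunc_log 2 n.

(* Main.v *)
(** Upper bounds: a certificate names a vertex of an explicitly described unlabelled graph H of
    the class. Each vertex checks that the names of its neighbours are exactly the H-neighbours of
    its own name, and that name 0 is used only by one identifier known to all. The naming is then a
    covering of a connected graph with a fibre of size at most one, hence injective, so the network
    is an induced subgraph of H. It remains to describe H briefly. For a unit-square graph, the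
    ranks of all [x_u] and [x_u - 1], and likewise for y, take O(n log n) bits. In a triangle-free
    one, each unit cell of the grid contains at most two vertices, so a vertex is located by its
    cell and one bit; a walk of length O(n) visiting all vertices, recorded by the displacements
    between cells and the constant-size neighbourhoods, takes O(n) bits.

    Lower bound: a fooling set over a cut of six vertices. Two ladders start from a common corner
    and have their far ends joined by a path of length 3. The squares of the ladders force one to
    descend and the other to ascend while both advance to the right; the short path then keeps them
    so close together that all leaves pending between them lie in a strip of height 1. The leaves
    are pairwise non-adjacent, hence at horizontal distance greater than 1, while each one lies
    within [i + 1] of the corner if it hangs from the [i]-th vertex of its ladder. So the first [i]
    positions carry at most [i] leaves. The leaves of the first ladder encode a word, those of the
    second its complement, and combining two different words exceeds this bound. *)

From Stdlib Require Import Reals Lra ZArith Classical ClassicalEpsilon FunctionalExtensionality.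
Require Import Defs.
From HB Require Import structures.
From mathcomp Require Import all_boot zify ssrZ.
Set Implicit Arguments. Unset Strict Implicit. Unset Printing Implicit Defensive.

(* The ssrint library, loaded by zify, takes over the delimiter R. *)
Delimit Scope R_scope with R.

(** * The certification scheme *)

(** Self-delimiting code: each binary digit, lowest first, is preceded by [true], and [false] ends
    the word. Halving makes fuel [k] sufficient. *)
Fixpoint nat_code_rec (fuel k : nat) : seq bool :=
  if k is 0 then [:: false]
  else if fuel is f.+1 then [:: true, odd k & nat_code_rec f k./2]
  else [:: false].

Definition nat_code (k : nat) : seq bool := nat_code_rec k k.

Lemma nat_code_rec_cat_inj f g a b s t : a <= f -> b <= g ->
  nat_code_rec f a ++ s = nat_code_rec g b ++ t -> a = b /\ s = t.
Proof.
elim: f g a b => [|f IH] [|g] [|a] [|b] //=; try by move=> _ _ [].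
move=> le_af le_bg [par_eq tail_eq].
have [] := IH g (uphalf a) (uphalf b) _ _ tail_eq; [lia|lia|move=> half_eq ->].
split=> //; lia.
Qed.

Lemma nat_code_cat_inj a b s t :
  nat_code a ++ s = nat_code b ++ t -> a = b /\ s = t.
Proof. exact: nat_code_rec_cat_inj. Qed.

Lemma size_nat_code_rec f a e : a < 2 ^ e -> size (nat_code_rec f a) <= e.*2.+1.
Proof.
elim: f a e => [|f IH] [|a] [|e] //=.
rewrite expnS => lt_a; rewrite !ltnS.
by apply: IH; lia.
Qed.

Lemma size_nat_code a e : a < 2 ^ e -> size (nat_code a) <= e.*2.+1.
Proof. exact: size_nat_code_rec. Qed.

Lemma flatten_prefix_code_inj (T : Type) (code : T -> seq bool) :
  (forall a, code a <> [::]) ->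
  (forall a b s t, code a ++ s = code b ++ t -> a = b /\ s = t) ->
  injective (fun l => flatten (map code l)).
Proof.
move=> code_nil code_inj; elim=> [|a l IH] [|b m] //=.
- by case E: (code b) (code_nil b).
- by case E: (code a) (code_nil a).
- by move=> /code_inj [-> /IH ->].
Qed.

Lemma size_flatten_code (T : Type) (code : T -> seq bool) (P : pred T) (C : nat) l :
  (forall a, P a -> size (code a) <= C) -> all P l ->
  size (flatten (map code l)) <= C * size l.
Proof.
move=> code_le; elim: l => [|a l IH] //= /andP[Pa /IH le_l].
by rewrite size_cat mulnS leq_add ?code_le.
Qed.

Lemma view_nbrsP n (adj : rel 'I_n) id cert v k w : injective id ->
  view_nbrs adj id cert v k = Some w <->
  exists u, [/\ adj v u, id u = k & cert u = w].
Proof.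
move=> id_inj; rewrite /view_nbrs; case: pickP => [u /andP[vu /eqP uk]|none].
  split=> [[<-]|[u' [_ u'k <-]]]; first by exists u.
  by congr (Some (cert _)); apply: id_inj; rewrite uk.
by split=> // -[u [vu uk _]]; have := none u; rewrite vu uk eqxx.
Qed.

(** Verifiers are arbitrary Boolean functions, so a local check stated as a proposition can be
    decided classically. *)
Definition propb (P : Prop) : bool := if excluded_middle_informative P then true else false.

Lemma propbP P : reflect P (propb P).
Proof. by rewrite /propb; case: excluded_middle_informative => H; constructor. Qed.

Definition iso_to n (adj : rel 'I_n) m (gr : rel 'I_m) (f : 'I_n -> 'I_m) : Prop :=
  bijective f /\ forall u v, adj u v = gr (f u) (f v).

Definition hereditary (cls : forall n, rel 'I_n -> Prop) : Prop :=
  forall n m (adj : rel 'I_n) (gr : rel 'I_m) (f : 'I_n -> 'I_m), injective f ->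
    (forall u v, adj u v = gr (f u) (f v)) -> cls m gr -> cls n adj.

(* A locally bijective map onto a connected graph with an at most one-element fibre is injective:
   two points of a common fibre would lift a path to the small fibre to two distinct points. *)
Lemma covering_injective n m (adj : rel 'I_n) (gr : rel 'I_m) (f : 'I_n -> 'I_m) (z : 'I_m) :
  symmetric adj ->
  (forall u v, adj u v -> gr (f u) (f v)) ->
  (forall u v w, adj u v -> adj u w -> f v = f w -> v = w) ->
  (forall u y, gr (f u) y -> exists2 v, adj u v & f v = y) ->
  (forall x y, connect gr x y) ->
  (forall u v, f u = z -> f v = z -> u = v) ->
  injective f.
Proof.
move=> symA homf locinj locsurj conn fib u v fuv.
have /connectP[p path_p last_p] := conn (f u) z.
elim: p u v fuv path_p last_p => [|y p IH] u v fuv /=.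
  by move=> _ zE; apply: fib; rewrite -?fuv zE.
case/andP=> gy path_p last_p.
have [u' uu' u'y] := locsurj _ _ gy.
rewrite fuv in gy; have [v' vv' v'y] := locsurj _ _ gy.
have E : u' = v' by apply: IH; rewrite ?u'y ?v'y.
apply: (locinj u'); rewrite ?fuv //; first by rewrite symA.
by rewrite E symA.
Qed.

Section Scheme.

Variables (cls : forall n, rel 'I_n -> Prop).
Variables (D : Type) (codeD : D -> seq bool) (num : D -> nat) (gr : forall d, rel 'I_(num d)).

(* [x]: name of the vertex in [gr d]; [r]: identifier of the vertex with name 0. *)
Definition certificate (x r : nat) (d : D) : seq bool :=
  nat_code x ++ nat_code r ++ codeD d.

(** The third condition bounds the fibre over name 0. The fourth spreads [d] and [r] along edges and
    makes the naming a homomorphism; the fifth makes it bijective on neighbourhoods. *)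
Definition local_check (i : nat) (w : seq bool) (view : nat -> option (seq bool)) : Prop :=
  exists (d : D) (r : nat) (x : 'I_(num d)),
    [/\ w = certificate x r d,
        cls (@gr d) /\ (forall y z : 'I_(num d), connect (@gr d) y z),
        (x = 0 :> nat -> i = r),
        (forall k w', view k = Some w' ->
           exists y : 'I_(num d), w' = certificate y r d /\ gr x y) &
        (forall y : 'I_(num d), gr x y ->
           exists k, view k = Some (certificate y r d) /\
             forall k', view k' = Some (certificate y r d) -> k' = k)].

Hypothesis codeD_inj : injective codeD.

Lemma certificate_inj x x' r r' d d' :
  certificate x r d = certificate x' r' d' -> [/\ x = x', r = r' & d = d'].
Proof. by move=> /nat_code_cat_inj[-> /nat_code_cat_inj[-> /codeD_inj ->]]. Qed.

Lemma scheme_sound n (adj : rel 'I_n) (id : 'I_n -> nat) (cert : 'I_n -> seq bool) :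
  hereditary cls -> 0 < n -> simple_connected adj -> injective id ->
  (forall v, local_check (id v) (cert v) (view_nbrs adj id cert v)) -> cls adj.
Proof.
move=> her n_gt0 [symA [irrA connA]] id_inj chk.
pose v0 := Ordinal n_gt0.
have viewP := view_nbrsP adj cert _ _ _ id_inj.
have [d [r [x0 [cert0 [cls_d conn_d] _ _ _]]]] := chk v0.
pose has_label w := exists y : 'I_(num d), w = certificate y r d.
(* Connectivity will carry the pair [d], [r] read at [v0] to every certificate. *)
have step u v : adj u v -> has_label (cert u) -> has_label (cert v).
  move=> uv [y certu].
  have [d' [r' [x' [certu' _ _ nbr _]]]] := chk u.
  have [_ Er Ed] := certificate_inj (etrans (esym certu) certu'); subst d' r'.
  have [|z [-> _]] := nbr (id v) (cert v); first by apply/viewP; exists v.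
  by exists z.
have lab_path p u : has_label (cert u) -> path adj u p -> has_label (cert (last u p)).
  by elim: p u => [|w p IH] u //= lu /andP[uw]; apply/IH/(step u).
have lab v : has_label (cert v).
  have /connectP[p path_p ->] := connA v0 v.
  by apply: lab_path; rewrite // cert0; eexists.
pose f v := proj1_sig (constructive_indefinite_description _ (lab v)).
have fE v : cert v = certificate (f v) r d.
  by rewrite /f; case: constructive_indefinite_description.
have {}chk v : [/\ (f v = 0 :> nat -> id v = r),
    (forall k w', view_nbrs adj id cert v k = Some w' ->
           exists y : 'I_(num d), w' = certificate y r d /\ gr (f v) y) &
    (forall y : 'I_(num d), gr (f v) y ->
           exists k, view_nbrs adj id cert v k = Some (certificate y r d) /\
             forall k', view_nbrs adj id cert v k' = Some (certificate y r d) -> k' = k)].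
  have [d' [r' [x' [certv _ root nbr cov]]]] := chk v.
  have [Ex Er Ed] := certificate_inj (etrans (esym (fE v)) certv); subst d' r'.
  by have -> : f v = x' by apply: val_inj.
have homf u v : adj u v -> gr (f u) (f v).
  have [_ nbr _] := chk u => uv.
  have [|z [certv guz]] := nbr (id v) (cert v); first by apply/viewP; exists v.
  have [Ez _ _] := certificate_inj (etrans (esym (fE v)) certv).
  by have -> : f v = z by apply: val_inj.
have locinj u v w : adj u v -> adj u w -> f v = f w -> v = w.
  move=> uv uw fvw; have [_ _ cov] := chk u.
  have [k [_ uniqk]] := cov _ (homf _ _ uv).
  apply: id_inj; rewrite (uniqk (id v)); last by apply/viewP; exists v.
  by apply/esym/uniqk/viewP; exists w; rewrite fE fvw.
have locsurj u y : gr (f u) y -> exists2 v, adj u v & f v = y.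
  have [_ _ cov] := chk u => /cov[k [/viewP[v [uv _ certv]] _]].
  have [Ey _ _] := certificate_inj (etrans (esym (fE v)) certv).
  by exists v => //; apply: val_inj.
have num_gt0 : 0 < num d by case: (f v0) => x; case: (num d).
have f_inj : injective f.
  apply: (@covering_injective _ _ adj (@gr d) f (Ordinal num_gt0)) => // u v fu fv.
  have [rootu _ _] := chk u; have [rootv _ _] := chk v.
  by apply: id_inj; rewrite rootu ?rootv // ?fu ?fv.
apply: (her _ _ adj (@gr d) f f_inj _ cls_d) => u v.
apply/idP/idP; first exact: homf.
by move=> /locsurj[w uw /f_inj <-].
Qed.

Lemma iso_connect n (adj : rel 'I_n) m (G : rel 'I_m) (f : 'I_n -> 'I_m) :
  iso_to adj G f -> (forall u v, connect adj u v) -> forall x y, connect G x y.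
Proof.
move=> [[g fK gK] fE] conn x y; rewrite -[x]gK -[y]gK.
have /connectP[p path_p ->] := conn (g x) (g y).
apply/connectP; exists (map f p); last by rewrite last_map.
by rewrite path_map (eq_path (e' := adj)) // => u v /=; rewrite fE.
Qed.

Lemma iso_hereditary n (adj : rel 'I_n) m (G : rel 'I_m) (f : 'I_n -> 'I_m) :
  hereditary cls -> iso_to adj G f -> cls adj -> cls G.
Proof.
move=> her [[g fK gK] fE]; apply: (her _ _ G adj g (can_inj gK)) => u v.
by rewrite fE !gK.
Qed.

Lemma scheme_complete n (adj : rel 'I_n) (id : 'I_n -> nat) d (f : 'I_n -> 'I_(num d)) r :
  hereditary cls -> cls adj -> simple_connected adj -> injective id ->
  iso_to adj (@gr d) f -> (forall v, f v = 0 :> nat -> id v = r) ->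
  forall v, local_check (id v) (certificate (f v) r d)
              (view_nbrs adj id (fun u => certificate (f u) r d) v).
Proof.
move=> her cls_adj [symA [irrA connA]] id_inj iso root v.
have f_inj := bij_inj iso.1; have fE := iso.2.
have viewP := view_nbrsP adj (fun u => certificate (f u) r d) _ _ _ id_inj.
exists d, r, (f v); split=> //.
- split; first exact: iso_hereditary iso cls_adj.
  exact: iso_connect iso connA.
- exact: root.
- move=> k w /viewP[u [vu _ <-]].
  by exists (f u); rewrite -fE.
- case: iso => -[g fK gK] _ y; rewrite -[y]gK -fE => vg; exists (id (g y)); split.
    by apply/viewP; exists (g y).
  move=> k /viewP[u [_ <- /certificate_inj[/val_inj/f_inj -> _ _]]].
  by [].
Qed.

End Scheme.

Lemma Nat_powE m e : Nat.pow m e = m ^ e.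
Proof. by elim: e => //= e ->; rewrite expnS. Qed.

Lemma leq_pow2r e m n : m <= n -> m ^ e <= n ^ e.
Proof. by case: e => // e le_mn; rewrite leq_exp2r. Qed.

Definition root_id n (id f : 'I_n -> nat) : nat :=
  if [pick v | f v == 0] is Some v then id v else 0.

(** A name costs O(log n) bits and the root identifier, at most [n ^ c], costs O(c log n); both are
    absorbed because [B n] is at least logarithmic. *)
Lemma scheme_upper (cls : forall n, rel 'I_n -> Prop) (c : nat) (B : nat -> nat) (K : nat)
    (D : Type) (codeD : D -> seq bool) (num : D -> nat) (gr : forall d, rel 'I_(num d)) :
  injective codeD -> hereditary cls -> (forall adj : rel 'I_0, cls 0 adj) ->
  (forall n (adj : rel 'I_n), 0 < n -> simple_connected adj -> cls n adj ->
     exists (d : D) (f : 'I_n -> 'I_(num d)),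
       iso_to adj (@gr d) f /\ size (codeD d) <= K * (B n).+1) ->
  (forall n, trunc_log 2 n <= B n) ->
  lc_bigO cls c B.
Proof.
move=> codeD_inj her cls0 repr logB.
pose ok n (adj : rel 'I_n) (df : {d : D & 'I_n -> 'I_(num d)}) :=
  iso_to adj (@gr (tag df)) (tagged df) /\ size (codeD (tag df)) <= K * (B n).+1.
pose P : prover_t := fun n adj id v =>
  match excluded_middle_informative (exists df, ok n adj df) with
  | left ex =>
    let df := proj1_sig (constructive_indefinite_description _ ex) in
    certificate codeD (tagged df v) (root_id id (fun u => tagged df u)) (tag df)
  | right _ => [::]
  end.
pose V : verifier_t := fun i w view => propb (local_check cls codeD gr i w view).
have PE n (adj : rel 'I_n) id : 0 < n -> simple_connected adj -> cls n adj ->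
    exists (d : D) (f : 'I_n -> 'I_(num d)),
      [/\ iso_to adj (@gr d) f, size (codeD d) <= K * (B n).+1 &
          forall v, P n adj id v = certificate codeD (f v) (root_id id (fun u => f u)) d].
  move=> n_gt0 sc cls_adj; rewrite /P.
  case: excluded_middle_informative => [ex|[]]; last first.
    by have [d [f [iso sz]]] := repr n adj n_gt0 sc cls_adj; exists (existT _ d f).
  case: constructive_indefinite_description => -[d f] [/= iso sz].
  by exists d, f; split.
have rootP n (id : 'I_n -> nat) m (f : 'I_n -> 'I_m) v :
    injective f -> f v = 0 :> nat -> id v = root_id id (fun u => f u).
  move=> f_inj fv0; rewrite /root_id; case: pickP => [u /eqP fu0|none]; last by have := none v; rewrite /= fv0.
  by congr id; apply: f_inj; apply: val_inj; rewrite /= fv0.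
exists (K + 4 * c + 12), P, V; split; first split.
- move=> n adj id sc [id_inj _] cls_adj v; apply/propbP.
  have n_gt0 : 0 < n by case: v => i; case: (n).
  have [d [f [iso _ certE]]] := PE n adj id n_gt0 sc cls_adj.
  have -> : P n adj id = fun u => certificate codeD (f u) (root_id id (fun u => f u)) d.
    exact: functional_extensionality.
  apply: (scheme_complete codeD_inj her cls_adj sc id_inj iso) => u.
  exact: rootP (bij_inj iso.1).
- move=> n adj id cert sc [id_inj _] ncls; apply: NNPP => noreject; apply: ncls.
  (* On the empty graph there is no vertex to reject, so the class has to contain it. *)
  case: n adj id cert sc id_inj noreject => [|n] adj id cert sc id_inj noreject; first exact: cls0.
  apply: (@scheme_sound cls D codeD num gr codeD_inj n.+1 adj id cert) => // v; apply/propbP.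
  by apply/negPn/negP => /negbTE rej; apply: noreject; exists v.
move=> n adj id v sc [id_inj id_le] cls_adj.
have n_gt0 : 0 < n by case: v => i; case: (n).
have [d [f [iso sz certE]]] := PE n adj id n_gt0 sc cls_adj.
pose l := (trunc_log 2 n).+1.
have lt_n : n < 2 ^ l by apply: trunc_log_ltn.
have num_n : num d = n.
  by have := bij_eq_card iso.1; rewrite !card_ord.
have sz_name : size (nat_code (f v)) <= l.*2.+1.
  apply: size_nat_code; apply: leq_trans (ltn_ord _) _; rewrite num_n; exact: ltnW.
have sz_root : size (nat_code (root_id id (fun u => f u))) <= (l * c).+1.*2.+1.
  apply: size_nat_code; rewrite /root_id; case: pickP => [u _|_]; last by rewrite expn_gt0.
  have /andP[_] := id_le u; rewrite Nat_powE => le_id.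
  apply: leq_ltn_trans le_id _; apply: leq_ltn_trans (leq_pow2r c (ltnW lt_n)) _.
  by rewrite -expnM ltn_exp2l.
rewrite certE !size_cat; move: (logB n) sz sz_name sz_root; rewrite /l => {lt_n l}.
move: (trunc_log 2 n) => t le_tB sz sz_name sz_root; clear -le_tB sz sz_name sz_root.
have le_tcB : t * c <= B n * c by rewrite leq_mul2r le_tB orbT.
nia.
Qed.

(** * Describing unit-square graphs by ranks *)

Lemma Rmax_leP x y z : (Rmax x y <= z)%R <-> (x <= z)%R /\ (y <= z)%R.
Proof.
split=> [le_z|[xz yz]]; last exact: Rmax_lub.
by split; apply: Rle_trans le_z; [apply: Rmax_l|apply: Rmax_r].
Qed.

Lemma Rabs_le1P x y : (Rabs (x - y) <= 1)%R <-> (x - 1 <= y)%R /\ (y - 1 <= x)%R.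
Proof. by rewrite /Rabs; case: Rcase_abs => ?; lra. Qed.

Definition count_below n (f : 'I_n -> R) (t : R) : nat := #|[pred w | propb (f w < t)%R]|.

Lemma count_below_le n (f : 'I_n -> R) t : count_below f t <= n.
Proof. by rewrite -{2}(card_ord n); apply: max_card. Qed.

(** If [f v < t], then [v] itself is counted below [t] but not below [f v]. *)
Lemma count_below_leP n (f : 'I_n -> R) t v :
  (t <= f v)%R <-> count_below f t <= count_below f (f v).
Proof.
split=> [le_t|]; first by apply/subset_leq_card/subsetP => w /propbP ltw; apply/propbP; lra.
move=> le_c; apply: Rnot_lt_le => lt_t; move: le_c; rewrite leqNgt => /negP; apply.
apply: proper_card; apply/properP; split.
  by apply/subsetP => w /propbP ltw; apply/propbP; lra.
by exists v; [apply/propbP|apply/negP => /propbP]; lra.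
Qed.

(* For each coordinate, the ranks of [x_u - 1] and of [x_u] among all the [x_w]. *)
Definition ranks := (nat * nat * (nat * nat))%type.

Definition ranks_code (a : ranks) : seq bool :=
  nat_code a.1.1 ++ nat_code a.1.2 ++ nat_code a.2.1 ++ nat_code a.2.2.

Definition ranks_near (a b : ranks) : bool :=
  [&& a.1.1 <= b.1.2, b.1.1 <= a.1.2, a.2.1 <= b.2.2 & b.2.1 <= a.2.2].

Definition ranks_graph (d : seq ranks) : rel 'I_(size d) :=
  fun u v => (u != v) && ranks_near (nth (0, 0, (0, 0)) d u) (nth (0, 0, (0, 0)) d v).

Lemma nat_code_neq0 k : nat_code k <> [::].
Proof. by case: k. Qed.

Lemma ranks_codes_inj : injective (fun d => flatten (map ranks_code d)).
Proof.
apply: flatten_prefix_code_inj => [[[a b] [c d]]|[[a b] [c d]] [[a' b'] [c' d']] s t].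
  by rewrite /ranks_code /=; case: (nat_code a) (@nat_code_neq0 a).
rewrite /ranks_code /= -!catA.
by do 4 move=> /nat_code_cat_inj[->].
Qed.

Lemma usg_hereditary : hereditary usg_class.
Proof.
move=> n m adj gr f f_inj fE [p [p_inj pE]]; exists (p \o f); split.
  exact: inj_comp.
by move=> u v neq_uv; rewrite fE; apply: pE; rewrite inj_eq.
Qed.

(** Adjacency depends only on comparisons of the numbers [x_u - 1] with the numbers [x_v], which are
    comparisons of ranks by [count_below_leP]. *)
Lemma usg_ranks n (adj : rel 'I_n) : simple_connected adj -> usg_class adj ->
  exists (d : seq ranks) (f : 'I_n -> 'I_(size d)), iso_to adj (@ranks_graph d) f /\
    (size d = n) /\ all (fun a => [&& a.1.1 <= n, a.1.2 <= n, a.2.1 <= n & a.2.2 <= n]) d.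
Proof.
move=> [_ [irrA _]] [p [_ pE]].
pose rk (g : 'I_n -> R) u := (count_below g (g u - 1)%R, count_below g (g u)).
pose r u : ranks := (rk (fst \o p) u, rk (snd \o p) u).
pose d := map r (enum 'I_n).
have sz : size d = n by rewrite size_map size_enum_ord.
have nthE (u : 'I_n) : nth (0, 0, (0, 0)) d u = r u.
  by rewrite (nth_map u) ?size_enum_ord // nth_ord_enum.
exists d, (cast_ord (esym sz)); split; last split=> //.
  split=> [|u v].
    by exists (cast_ord sz) => u; apply: val_inj.
  rewrite /ranks_graph /= !nthE -val_eqE /= val_eqE.
  have [->|neq_uv] := eqVneq u v; first exact: irrA.
  have close : adj u v <-> ranks_near (r u) (r v).
    rewrite pE // Rmax_leP !Rabs_le1P.
    rewrite (count_below_leP (fst \o p) _ v) (count_below_leP (fst \o p) _ u).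
    rewrite (count_below_leP (snd \o p) _ v) (count_below_leP (snd \o p) _ u).
    by split=> [[[? ?] [? ?]]|/and4P[]]; [apply/and4P|].
  by apply/idP/idP => /close.
by apply/allP => a /mapP[u _ ->]; rewrite /= !count_below_le.
Qed.

Lemma usg_upper c : lc_bigO usg_class c nlogn.
Proof.
apply: (@scheme_upper _ _ _ 20 _ _ _ ranks_graph ranks_codes_inj usg_hereditary).
- move=> adj; exists (fun _ => (0, 0)%R); split; by case.
- move=> n adj n_gt0 sc cls_adj.
  have [d [f [iso [sz le_d]]]] := usg_ranks sc cls_adj; exists d, f; split=> //.
  pose t := trunc_log 2 n; have lt_n : n < 2 ^ t.+1 by apply: trunc_log_ltn.
  have le_code a : a <= n -> size (nat_code a) <= t.+1.*2.+1.
    by move=> le_a; apply: size_nat_code; apply: leq_ltn_trans lt_n.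
  have := @size_flatten_code _ ranks_code _ (t.+1.*2.+1 * 4) d _ le_d.
  rewrite sz => le_size; apply: leq_trans (le_size _) _.
    by move=> a /and4P[/le_code ? /le_code ? /le_code ? /le_code ?]; rewrite !size_cat; lia.
  (* The size is at most [(8 t + 12) n]. For [t >= 1] this is at most [20 t n]; for [n = 1] the
     successor in the bound pays for the 12 bits. *)
  rewrite /nlogn -/t; have [t_gt0|] := ltnP 0 t.
    by move: t t_gt0 {lt_n le_code le_size} => t t_gt0; nia.
  rewrite leqn0 trunc_log_eq0 /= => n_le1; have n1 : n = 1 by lia.
  by rewrite /t n1 trunc_log1.
- move=> [|n] //; rewrite /nlogn; exact: leq_pmull.
Qed.

(** * Describing triangle-free unit-square graphs by walks *)

Lemma finite_prefix_code (L : finType) : exists (code : L -> seq bool) (C : nat),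
  [/\ forall a, code a <> [::],
      forall a b s t, code a ++ s = code b ++ t -> a = b /\ s = t &
      forall a, size (code a) <= C].
Proof.
exists (fun a => nat_code (enum_rank a)), (#|L|.*2.+1); split=> [a|a b s t|a].
- exact: nat_code_neq0.
- by move=> /nat_code_cat_inj[/val_inj/enum_rank_inj -> ->].
- by apply: size_nat_code; apply: ltn_trans (ltn_ord _) (ltn_expl _ _).
Qed.

(* A visited vertex with an unvisited neighbour is replaced in the walk by a detour of length 2. *)
Lemma covering_walk n (adj : rel 'I_n) (x : 'I_n) : simple_connected adj ->
  exists p, [/\ path adj x p, forall v, v \in x :: p & size p <= n.*2].
Proof.
move=> [symA [_ connA]].
have grow m : m <= n ->
    exists p, [/\ path adj x p, m <= #|x :: p| & size p <= m.*2].
  elim: m => [|m IH] lt_m; first by exists [::].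
  have [p [path_p le_m size_p]] := IH (ltnW lt_m).
  have [lt_mp|le_pm] := ltnP m #|x :: p|; first by exists p; split=> //; lia.
  have [v vNp] : exists v, v \notin x :: p.
    apply/existsP; rewrite -negb_forall; apply/negP => /forallP all_p.
    suff : #|x :: p| = n by lia.
    by rewrite -[RHS](card_ord n); apply: eq_card => u; rewrite all_p.
  (* A path from [x] to an unvisited vertex has an edge leaving the visited set. *)
  have [u [w [up wNp uw]]] : exists u w, [/\ u \in x :: p, w \notin x :: p & adj u w].
    have /connectP[q] := connA x v.
    have : x \in x :: p by apply: mem_head.
    elim: q {1 3 4}x => [|z q IHq] y yp /=; first by move=> _ vE; rewrite vE yp in vNp.
    move=> /andP[yz path_q] lq; have [zp|zNp] := boolP (z \in x :: p); first exact: (IHq z).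
    by exists y, z.
  case/splitPl: up path_p le_m size_p le_pm vNp wNp => p1 p2 last1.
  rewrite cat_path last1 => /andP[path1 path2] le_m size_p _ _ wNp.
  exists (p1 ++ w :: u :: p2); split.
  - by rewrite cat_path /= last1 path1 uw symA uw path2.
  - apply: (@leq_trans #|w :: x :: p1 ++ p2|).
      have -> : #|w :: x :: p1 ++ p2| = #|[predU1 w & x :: p1 ++ p2]|.
        by apply: eq_card => z; rewrite !inE.
      by rewrite cardU1 wNp.
    apply/subset_leq_card/subsetP => z; rewrite !(inE, mem_cat).
    by case/or3P=> [->|->|/orP[->|->]]; rewrite ?orbT.
  - by move: size_p; rewrite !size_cat /= => ?; lia.
have [p [path_p le_p size_p]] := grow n (leqnn n).
exists p; split=> // v.
have card_p : #|x :: p| = #|'I_n|.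
  by apply: anti_leq; rewrite max_card [X in X <= _]card_ord.
by rewrite (elimT (subset_cardP card_p) (subset_predT _)).
Qed.

Lemma tf_usg_hereditary : hereditary tf_usg_class.
Proof.
move=> n m adj gr f f_inj fE [usg tf]; split; first exact: (usg_hereditary f_inj fE usg).
by move=> u v w; rewrite !fE; apply: tf.
Qed.

(* Target of a step: one of the 3 x 3 cells around the current one (0, 1, 2 stand for
   -1, 0, 1), and the bit that tells apart the two vertices of a cell. *)
Definition shift := ('I_3 * 'I_3 * bool)%type.
(** A step of the walk, with the displacements from the cell it reaches to all neighbours of the
    vertex it reaches. *)
Definition letter := (shift * {set shift})%type.
Definition name := (Z * Z * bool)%type.

Definition step (c : Z * Z) (m : shift) : name :=
  ((c.1 + Z.of_nat m.1.1 - 1)%Z, (c.2 + Z.of_nat m.1.2 - 1)%Z, m.2).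

Fixpoint trace (c : Z * Z) (l : seq letter) : seq (name * {set shift}) :=
  if l is a :: l' then (step c a.1, a.2) :: trace (step c a.1).1 l' else [::].

Definition names_adj (tr : seq (name * {set shift})) (x y : name) : bool :=
  has (fun z : name * {set shift} => (z.1 == x) && [exists m in z.2, y == step x.1 m]) tr.

(** The walk may revisit vertices, so repetitions are removed before names are numbered. *)
Definition walk_names (d : seq letter) : seq name := undup (map fst (trace (0, 0)%Z d)).

Definition walk_graph (d : seq letter) : rel 'I_(size (walk_names d)) :=
  let x0 := (0, 0, false)%Z in
  fun u v => names_adj (trace (0, 0)%Z d) (nth x0 (walk_names d) u) (nth x0 (walk_names d) v).

Lemma shift_coordinate (a b : Z) : (a - 1 <= b <= a + 1)%Z ->
  exists i : 'I_3, b = (a + Z.of_nat i - 1)%Z.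
Proof.
move=> le_ab; have lt3 : Z.to_nat (b - a + 1) < 3 by lia.
by exists (Ordinal lt3) => /=; lia.
Qed.

Lemma Int_part_near x y : (x - 1 <= y)%R -> (y - 1 <= x)%R ->
  (Int_part x - 1 <= Int_part y <= Int_part x + 1)%Z.
Proof.
move=> xy yx; have [x1 x2] := base_Int_part x; have [y1 y2] := base_Int_part y.
move: (Int_part x) (Int_part y) x1 x2 y1 y2 => i j x1 x2 y1 y2.
by split; apply/Zlt_succ_le/lt_IZR; rewrite ?succ_IZR ?minus_IZR ?plus_IZR; lra.
Qed.

Lemma Int_part_eq_near x y : Int_part x = Int_part y -> (x - 1 <= y)%R.
Proof.
move=> xy; have [x1 x2] := base_Int_part x; have [y1 y2] := base_Int_part y.
rewrite xy in x1 x2; lra.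
Qed.

Section WalkCode.

Variables (n : nat) (adj : rel 'I_n) (v0 : 'I_n) (p : 'I_n -> R * R).
Hypothesis irrA : irreflexive adj.
Hypothesis pE : forall u v, u != v ->
  (adj u v <-> (Rmax (Rabs (fst (p u) - fst (p v))) (Rabs (snd (p u) - snd (p v))) <= 1)%R).
Hypothesis tf : triangle_free adj.

(** Taken relative to the cell of [v0], so that every recorded walk starts at the same origin. *)
Let cell v : Z * Z :=
  ((Int_part (p v).1 - Int_part (p v0).1)%Z, (Int_part (p v).2 - Int_part (p v0).2)%Z).

Let vname v : name := (cell v, [exists u : 'I_n, (u < v) && (cell u == cell v)]).

Lemma adj_same_cell u v : u != v -> cell u = cell v -> adj u v.
Proof.
move=> neq_uv [cx cy]; apply/(pE neq_uv); rewrite Rmax_leP !Rabs_le1P.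
by split; split; apply: Int_part_eq_near; lia.
Qed.

(** Vertices of one cell are adjacent. If [u < v] share cell and bit, the bit of [v] is set because
    of [u], so that of [u] is set because of some [w], and [w], [u], [v] form a triangle. *)
Lemma vname_inj : injective vname.
Proof.
suff lt_neq (u v : 'I_n) : u < v -> vname u <> vname v.
  move=> u v uv; apply: val_inj; apply/eqP; rewrite eqn_leq.
  by apply/andP; split; rewrite leqNgt; apply/negP => /lt_neq; apply.
move=> lt_uv [cx cy bit].
have cuv : cell u = cell v by rewrite /cell cx cy.
have /existsP[w /andP[lt_wu /eqP cwu]] : [exists w : 'I_n, (w < u) && (cell w == cell u)].
  by rewrite bit; apply/existsP; exists u; rewrite lt_uv cuv eqxx.
apply: (tf (u := w) (v := u) (w := v)); split; last split.
- by apply: adj_same_cell; rewrite -?val_eqE ?neq_ltn ?lt_wu.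
- by apply: adj_same_cell; rewrite -?val_eqE ?neq_ltn ?lt_uv.
- by apply: adj_same_cell; rewrite ?cwu -?val_eqE //= neq_ltn (ltn_trans lt_wu).
Qed.

Lemma adj_step u v : adj u v -> exists m, vname v = step (cell u) m.
Proof.
move=> uv; have neq_uv : u != v by apply: contraTneq uv => ->; rewrite irrA.
have := uv; rewrite (pE neq_uv) Rmax_leP !Rabs_le1P => -[[x1 x2] [y1 y2]].
have [i iE] : exists i : 'I_3, (cell v).1 = ((cell u).1 + Z.of_nat i - 1)%Z.
  by apply: shift_coordinate; have := Int_part_near x1 x2; rewrite /cell /=; lia.
have [j jE] : exists j : 'I_3, (cell v).2 = ((cell u).2 + Z.of_nat j - 1)%Z.
  by apply: shift_coordinate; have := Int_part_near y1 y2; rewrite /cell /=; lia.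
by exists (i, j, (vname v).2); rewrite /step /= -iE -jE.
Qed.

Let nbr_shifts v : {set shift} := [set m | [exists u, adj v u && (step (cell v) m == vname u)]].

Let record v := (vname v, nbr_shifts v).

Lemma trace_walk q u : path adj u q ->
  exists l, size l = size q /\ trace (cell u) l = map record q.
Proof.
elim: q u => [|v q IH] u /=; first by exists [::].
move=> /andP[/adj_step[m mE] /IH[l [size_l lE]]].
exists ((m, nbr_shifts v) :: l); split; first by rewrite /= size_l.
by rewrite -[LHS]/((step (cell u) m, _) :: trace (step (cell u) m).1 l) -mE lE.
Qed.

Lemma names_adjE q u v : (forall w, w \in q) ->
  names_adj (map record q) (vname u) (vname v) = adj u v.
Proof.
move=> q_all; apply/hasP/idP => [[_ /mapP[w _ ->]]|uv] /=.
  move=> /andP[/eqP/vname_inj -> /exists_inP[m]].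
  by rewrite inE => /existsP[v' /andP[uv' /eqP ->]] /eqP/vname_inj ->.
exists (record u); first by apply: map_f.
rewrite /= eqxx /=; have [m mE] := adj_step uv.
apply/exists_inP; exists m; last exact/eqP.
by rewrite inE; apply/existsP; exists v; rewrite uv mE eqxx.
Qed.

Lemma walk_repr : simple_connected adj ->
  exists (d : seq letter) (f : 'I_n -> 'I_(size (walk_names d))), iso_to adj (@walk_graph d) f /\ size d <= n.*2.+1.
Proof.
move=> sc; have [q [path_q q_all size_q]] := covering_walk v0 sc.
have [l [size_l lE]] := trace_walk path_q.
have cell0 : cell v0 = (0, 0)%Z by rewrite /cell !Z.sub_diag.
(* Displacement 1 stands for 0: the first letter stays in the origin cell and serves to record [v0]
   itself. *)
have lt13 : 1 < 3 by []; pose one := Ordinal lt13.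
pose d : seq letter := ((one, one, (vname v0).2), nbr_shifts v0) :: l.
have dE : trace (0, 0)%Z d = map record (v0 :: q).
  have step0 : step (0, 0)%Z (one, one, (vname v0).2) = vname v0.
    by rewrite [RHS]surjective_pairing [(vname v0).1]cell0.
  by rewrite -[LHS]/((step (0, 0)%Z (one, one, _), _) :: trace (step (0, 0)%Z (one, one, _)).1 l)
    step0 lE.
have namesE x : (x \in walk_names d) = [exists v, x == vname v].
  rewrite mem_undup dE -map_comp; apply/mapP/existsP => [[v _ ->]|[v /eqP ->]].
    by exists v.
  by exists v.
have name_in v : vname v \in walk_names d by rewrite namesE; apply/existsP; exists v.
pose f v : 'I_(size (walk_names d)) := Ordinal (etrans (index_mem _ _) (name_in v)).
have fK v x0 : nth x0 (walk_names d) (f v) = vname v by apply: nth_index.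
exists d, f; split; last by rewrite /= size_l.
split=> [|u v]; last by rewrite /walk_graph !fK dE names_adjE.
have f_inj : injective f.
  by move=> u v fuv; apply: vname_inj; rewrite -(fK u (vname u)) fuv fK.
apply: (inj_card_bij f_inj); rewrite card_ord.
have -> : #|'I_n| = size (map vname (enum 'I_n)) by rewrite size_map -cardE.
apply: uniq_leq_size; first exact: undup_uniq.
by move=> x; rewrite namesE => /existsP[v /eqP ->]; apply: map_f; rewrite mem_enum.
Qed.

End WalkCode.

Lemma tf_usg_upper c : lc_bigO tf_usg_class c id.
Proof.
have [code [C [code_nil code_inj code_le]]] := finite_prefix_code letter.
have codes_inj := flatten_prefix_code_inj code_nil code_inj.
apply: (@scheme_upper _ _ _ (2 * C) _ _ _ walk_graph codes_inj tf_usg_hereditary).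
- move=> adj; split; last by case.
  by exists (fun _ => (0, 0)%R); split; case.
- move=> n adj n_gt0 sc [[p [_ pE]] tf].
  have irrA : irreflexive adj by case: sc => _ [].
  have [d [f [iso size_d]]] := walk_repr (Ordinal n_gt0) irrA pE tf sc.
  exists d, f; split=> //.
  apply: leq_trans (@size_flatten_code _ code predT C d _ _) _ => //; first exact/allP.
  by rewrite [2 * C]mulnC -mulnA leq_mul2l; apply/orP; right; apply: leq_trans size_d _ => /=; lia.
- by move=> n; have [->//|n_gt0] := posnP n; exact: ltnW (leq_trans (ltn_expl _ _) (trunc_logP _ _)).
Qed.

(** * Fooling sets *)

(** The appended [true] marks the end of the word, so padding with [false] loses nothing on words
    shorter than [L]. *)
Definition pad (L : nat) (w : seq bool) : L.-tuple bool :=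
  [tuple nth false (rcons w true) i | i < L].

Lemma pad_inj L w w' : size w < L -> size w' < L -> pad L w = pad L w' -> w = w'.
Proof.
move=> lt_w lt_w' pad_eq.
have nth_eq i : nth false (rcons w true) i = nth false (rcons w' true) i.
  have [lt_i|le_i] := ltnP i L; last by rewrite !nth_default ?size_rcons //; lia.
  by have := congr1 (fun u : L.-tuple bool => tnth u (Ordinal lt_i)) pad_eq; rewrite !tnth_mktuple.
have size_le v v' : (forall i, nth false (rcons v true) i = nth false (rcons v' true) i) ->
    size v <= size v'.
  move=> vE; rewrite leqNgt; apply/negP => lt_v; have := vE (size v).
  by rewrite nth_rcons ltnn eqxx nth_default // size_rcons.
have /rcons_inj[] // : rcons w true = rcons w' true.
apply: (@eq_from_nth _ false) => // ; rewrite !size_rcons; congr _.+1.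
by apply: anti_leq; rewrite !size_le.
Qed.

Lemma view_nbrs_ext n (adj adj' : rel 'I_n) id cert cert' u :
  (forall v, adj u v = adj' u v) -> (forall v, adj u v -> cert v = cert' v) ->
  view_nbrs adj id cert u = view_nbrs adj' id cert' u.
Proof.
move=> adjE certE; apply: functional_extensionality => k; rewrite /view_nbrs.
rewrite (eq_pick (Q := fun v => adj' u v && (id v == k))); last by move=> v; rewrite /= adjE.
by case: pickP => // v /andP[uv _]; rewrite certE // adjE.
Qed.

Section FoolingSet.

Variables (cls : forall n, rel 'I_n -> Prop) (c n m : nat) (S : finType).
Variables (side : pred 'I_n) (F : 'I_m -> 'I_n) (G : S -> S -> rel 'I_n).
Hypothesis G_conn : forall s t, simple_connected (G s t).
Hypothesis G_cls : forall s, cls (G s s).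
Hypothesis G_ncls : forall s t, s <> t -> ~ (cls (G s t) /\ cls (G t s)).
Hypothesis G_left : forall s t t' u v, side u -> G s t u v = G s t' u v.
Hypothesis G_right : forall s s' t u v, ~~ side u -> G s t u v = G s' t u v.
Hypothesis G_cut : forall s t u v, side u != side v -> G s t u v -> exists i, v = F i.

(** If the certificates for [s] and [t] agree on the cut, gluing them along [side] shows each vertex
    of [G s t] a view it accepts in [G s s] or [G t t]. Likewise for [G t s], so the certificates on
    the cut determine [s]. *)
Lemma fooling_set P V (id : 'I_n -> nat) L : pls cls c P V -> valid_ids c id ->
  (forall s v, size (P n (G s s) id v) < L) -> #|S| <= 2 ^ (L * m).
Proof.
move=> [complete sound] id_ok lt_L.
have mix s t : (forall i, P n (G s s) id (F i) = P n (G t t) id (F i)) -> cls (G s t).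
  move=> agree; apply: NNPP => /(sound _ _ id _ (G_conn s t) id_ok) rej.
  pose cert v := if side v then P n (G s s) id v else P n (G t t) id v.
  have [u] := rej cert; rewrite /accepts.
  have [side_u|side_u] := boolP (side u).
    rewrite (_ : view_nbrs _ _ _ _ = view_nbrs (G s s) id (P n (G s s) id) u).
      have := complete _ _ _ (G_conn s s) id_ok (G_cls s) u.
      by rewrite /accepts {1}/cert side_u => ->.
    apply: view_nbrs_ext => [v|v uv]; first exact: G_left.
    rewrite /cert; case: ifPn => // side_v.
    have [|i ->] := G_cut _ uv; first by rewrite side_u (negbTE side_v).
    by rewrite agree.
  rewrite (_ : view_nbrs _ _ _ _ = view_nbrs (G t t) id (P n (G t t) id) u).
    have := complete _ _ _ (G_conn t t) id_ok (G_cls t) u.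
    by rewrite /accepts {1}/cert (negbTE side_u) => ->.
  apply: view_nbrs_ext => [v|v uv]; first exact: G_right.
  rewrite /cert; case: ifPn => // side_v.
  have [|i ->] := G_cut _ uv; first by rewrite side_v (negbTE side_u).
  by rewrite agree.
pose f s := [ffun i : 'I_m => pad L (P n (G s s) id (F i))].
have f_inj : injective f.
  move=> s t fst; apply: NNPP => neq_st.
  have agree i : P n (G s s) id (F i) = P n (G t t) id (F i).
    by have /ffunP/(_ i) := fst; rewrite !ffunE; apply: pad_inj.
  by case: (G_ncls neq_st); split; apply: mix.
have := leq_card f f_inj.
by rewrite card_ffun card_tuple card_bool card_ord -expnM.
Qed.

End FoolingSet.

(** * The gadget and its drawing for equal words *)

(* [rail x i] and [outer x i] are the ladder on side [x]: the rail runs through [corner],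
   [rail x 0], [rail x 1], ... and faces the other ladder, and [outer x i] is matched with the
   [i]-th vertex of the rail counted from [corner]. [inner] closes a 4-cycle at the corner,
   [tip false] and [tip true] join the ends of the rails, [tail i] only adjusts the number of
   vertices. *)
Inductive vtx :=
  | corner | inner | tip of bool | rail of bool & nat | outer of bool & nat
  | leaf of bool & nat | tail of nat.

Lemma vtx_comparable : comparable vtx.
Proof. by move=> u v; rewrite /decidable; do 2 decide equality. Defined.

HB.instance Definition _ := hasDecEq.Build vtx (compareP vtx_comparable).

(* Letter [j] of the words chooses, on each side, which of the rail positions [2j+2] and [2j+3]
   carries a leaf; on equal letters the two sides choose differently. *)
Definition leaf_index (s t : nat -> bool) (x : bool) (j : nat) : nat :=
  j.*2.+2 + (if x then ~~ t j else s j).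
Arguments leaf_index : simpl never.

(** Each edge is listed in one direction. Positions on a rail are counted from [corner], so
    [rail x i] has position [i + 1]. *)
Definition arc (k : nat) (s t : nat -> bool) (u v : vtx) : bool :=
  match u, v with
  | corner, rail _ i | corner, outer _ i | inner, rail _ i => i == 0
  | rail x i, rail y j | rail x i, outer y j | outer x i, outer y j => (x == y) && (j == i.+1)
  | rail x i, leaf y j => (x == y) && (leaf_index s t y j == i.+1)
  | rail x i, tip y => (x == y) && (k == i.+1)
  | tip x, tip y => ~~ x && y
  | outer x i, tail j => [&& ~~ x, i == 0 & j == 0]
  | tail i, tail j => j == i.+1
  | _, _ => false
  end.

Definition edge k s t u v : bool := arc k s t u v || arc k s t v u.

Definition wf (h q : nat) (u : vtx) : bool :=
  match u with
  | rail _ i => i < h.*2.+2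
  | outer _ i => i <= h.*2.+2
  | leaf _ j => j < h
  | tail i => i < q
  | _ => true
  end.

Definition sgn (x : bool) : Z := if x then 1%Z else (-1)%Z.

(* A drawing for equal words, in which the threshold for adjacency is [K = 2k]. Rail steps are
   [K - 1] long and consecutive leaves are [K + 1] apart: over [k] steps the difference adds up
   to no more than [K]. *)
Definition pos (k : Z) (s : nat -> bool) (u : vtx) : Z * Z :=
  let K := (2 * k)%Z in
  match u with
  | corner => (0, 0)%Z
  | inner => (K + 1, 0)%Z
  | tip x => (k * K + k, sgn x * k)%Z
  | rail x i => ((Z.of_nat i + 1) * (K - 1), sgn x * (K + Z.of_nat i))%Z
  | outer x 0 => (- k, sgn x * K)%Z
  | outer x i.+1 => ((Z.of_nat i + 1) * (K - 1) - k, sgn x * (2 * K + Z.of_nat i))%Z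
  | leaf x j => let i := Z.of_nat (leaf_index s s x j) in (i * (K + 1), sgn x * (i - 1))%Z
  | tail i => (- k - (Z.of_nat i + 1) * K, - K)%Z
  end.

(** Coordinates contain products of an index with [k]. Splitting by whether two indices are equal,
    consecutive or further apart leaves linear facts for [lia]. *)
Lemma mul_cases (k a b : Z) : (0 < k)%Z ->
  (a = b /\ a * k = b * k \/ a = b + 1 /\ a * k = b * k + k \/
   b = a + 1 /\ b * k = a * k + k \/ a + 2 <= b /\ a * k + 2 * k <= b * k \/
   b + 2 <= a /\ b * k + 2 * k <= a * k)%Z.
Proof.
move=> k_gt0; have [->|[->|[->|[le_ab|le_ba]]]] :
  (a = b \/ a = b + 1 \/ b = a + 1 \/ a + 2 <= b \/ b + 2 <= a)%Z by lia.
- by left.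
- by right; left; lia.
- by right; right; left; lia.
- by do 3 right; left; split; nia.
- by do 4 right; split; nia.
Qed.

Lemma leaf_index_bounds h s t x j : j < h -> 2 <= leaf_index s t x j <= h.*2.+1.
Proof. by rewrite /leaf_index; case: x; case: (s j); case: (t j); lia. Qed.

(** With equal words, letter [j] uses both positions [2j+2] and [2j+3], one on each side. *)
Lemma leaf_index_inj s x y i j : leaf_index s s x i = leaf_index s s y j -> x = y /\ i = j.
Proof.
rewrite /leaf_index => E; have ij : i = j by case: x y E => [] [] /=; lia.
by subst j; case: x y E => [] []; case: (s i) => /=; lia.
Qed.

(* The multiplier of [K] in the abscissa, up to an additive constant. *)
Definition column (h : nat) (s : nat -> bool) (u : vtx) : nat :=
  match u with
  | tip _ => h.*2.+2
  | rail _ i | tail i => i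
  | outer _ i => i.-1
  | leaf x j => leaf_index s s x j
  | _ => 0
  end.

Lemma pos_edge h q s u v (k : Z) : k = Z.of_nat h.*2.+2 -> wf h q u -> wf h q v -> u != v ->
  (edge h.*2.+2 s s u v <->
  ((- (2 * k) <= (pos k s u).1 - (pos k s v).1 <= 2 * k) /\
   (- (2 * k) <= (pos k s u).2 - (pos k s v).2 <= 2 * k))%Z) /\
  ~ ((pos k s u).1 = (pos k s v).1 /\ (pos k s u).2 = (pos k s v).2).
Proof.
rewrite /edge => kE.
have k_ge2 : (2 <= k)%Z by lia.
have k_gt0 : (0 < k)%Z by lia.
have := mul_cases (Z.of_nat (column h s u)) (Z.of_nat (column h s v)) k_gt0.
have := @mul_cases k (Z.of_nat (column h s u)) 0%Z k_gt0.
have := @mul_cases k (Z.of_nat (column h s v)) 0%Z k_gt0.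
case: u => [| |x|x i|x [|i]|x i|i]; case: v => [| |y|y j|y [|j]|y j|j]; try case: x; try case: y.
all: cbv beta iota zeta delta [wf pos arc fst snd sgn column].
all: move=> cv cu cuv wu wv neq_uv.
all: try (by rewrite eqxx in neq_uv).
all: try (match type of cu with context [leaf_index _ _ ?x _] =>
  have := leaf_index_bounds s s x wu end).
all: try (match type of cv with context [leaf_index _ _ ?x _] =>
  have := leaf_index_bounds s s x wv end).
all: try (match type of neq_uv with is_true (?f ?i != ?f ?j) =>
  have neq_ij : i <> j by (move=> ij; rewrite ij eqxx in neq_uv) end).
all: try (match type of neq_uv with is_true (leaf ?x ?i != leaf ?y ?j) =>
  have neq_index : leaf_index s s x i <> leaf_index s s y j by
    (move=> /leaf_index_inj[xy ij]; first [discriminate xy | rewrite ij eqxx in neq_uv]) end).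
all: lia.
Qed.

(** * Plane geometry of induced 4-cycles and ladders *)

Definition near (p q : R * R) : Prop :=
  ((p.1 - 1 <= q.1 /\ q.1 - 1 <= p.1) /\ (p.2 - 1 <= q.2 /\ q.2 - 1 <= p.2))%R.

Definition far (p q : R * R) : Prop :=
  (p.1 + 1 < q.1 \/ q.1 + 1 < p.1 \/ p.2 + 1 < q.2 \/ q.2 + 1 < p.2)%R.

Lemma near_sym p q : near p q -> near q p.
Proof. by rewrite /near; tauto. Qed.

Lemma far_sym p q : far p q -> far q p.
Proof. by rewrite /far; tauto. Qed.

Lemma not_nearP p q : ~ near p q <-> far p q.
Proof.
rewrite /near /far; split=> [nnear|]; last by lra.
apply: NNPP => nfar; apply: nnear; repeat split; apply: Rnot_lt_le; lra.
Qed.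

(* [square l b r t]: a 4-cycle with its vertices in left, bottom, right, top position. *)
Definition square (l b r t : R * R) : Prop := (l.1 + 1 < r.1 /\ b.2 + 1 < t.2)%R.

(* The other diagonals cannot be separated along the same axis. *)
Lemma square_fold p q r s : near p q -> near q r -> near r s -> near s p -> far p r -> far q s ->
  [\/ square p q r s \/ square p s r q, square r q p s \/ square r s p q,
      square q p s r \/ square q r s p | square s p q r \/ square s r q p].
Proof.
rewrite /near /far /square => pq qr rs sp fpr fqs.
case: fpr => [?|[?|[?|?]]]; case: fqs => [?|[?|[?|?]]]; try lra.
- by constructor 1; left; lra.
- by constructor 1; right; lra.
- by constructor 2; left; lra.
- by constructor 2; right; lra.
- by constructor 3; left; lra.
- by constructor 4; left; lra.
- by constructor 3; right; lra.
- by constructor 4; right; lra.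
Qed.

(** A 4-cycle glued to the edge [b r] keeps the orientation, with [b] now left and [r] now top. The
    non-adjacency of [l] and [b'] settles the cases that the new diagonals leave open. *)
Lemma square_east l b r t b' r' : square l b r t ->
  near l b -> near b r -> near r t -> near t l -> near b b' -> near b' r' -> near r' r ->
  far b r' -> far r b' -> far l b' -> square b b' r' r.
Proof.
rewrite /near /far /square => sq ? ? ? ? ? ? ? f1 f2 f3.
by case: f1 => [?|[?|[?|?]]]; case: f2 => [?|[?|[?|?]]]; try lra; case: f3 => [?|[?|[?|?]]]; lra.
Qed.

(** The analogue for a 4-cycle glued to the edge [l b]; it starts a ladder at the corner square. *)
Lemma square_south l b r t l' b' : square l b r t ->
  near l b -> near b r -> near r t -> near t l -> near l l' -> near l' b' -> near b' b ->
  far b l' -> far l b' -> far r b' -> square l' b' b l.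
Proof.
rewrite /near /far /square => sq ? ? ? ? ? ? ? f1 f2 f3.
by case: f1 => [?|[?|[?|?]]]; case: f2 => [?|[?|[?|?]]]; try lra; case: f3 => [?|[?|[?|?]]]; lra.
Qed.

Section Ladder.

Variables (k : nat) (a b : nat -> R * R).
Hypothesis a_step : forall i, i < k -> near (a i) (a i.+1).
Hypothesis b_step : forall i, i < k -> near (b i) (b i.+1).
Hypothesis rung : forall i, i <= k -> near (a i) (b i).
Hypothesis diag_ab : forall i, i < k -> far (a i) (b i.+1).
Hypothesis diag_ba : forall i, i < k -> far (b i) (a i.+1).
Hypothesis b_skip : forall i, i.+1 < k -> far (b i) (b i.+2).
Hypothesis square0 : 0 < k -> square (b 0) (b 1) (a 1) (a 0).

Lemma ladder_square i : i < k -> square (b i) (b i.+1) (a i.+1) (a i).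
Proof.
elim: i => [|i IH] lt_i; first exact: square0.
have lt_i' := ltnW lt_i.
have rung1 := rung lt_i'; have rung2 := rung lt_i; have rung0 := rung (ltnW lt_i').
have far1 := far_sym (diag_ab lt_i).
by apply: (square_east (IH lt_i')); first [by auto | by apply: near_sym; auto | by apply: far_sym; auto].
Qed.

(** [a i] is at most 1 to the right of [b i], but [a i.+1] is further; [a i.+1] is at most 1 above
    [b i.+1], but [a i] is higher. *)
Lemma ladder_step i : i < k ->
  ((a i).1 < (a i.+1).1 /\ (a i.+1).1 <= (a i).1 + 1 /\ (a i.+1).2 < (a i).2)%R.
Proof.
move=> lt_i; have := ladder_square lt_i; have := a_step lt_i.
by have := rung (ltnW lt_i); have := rung lt_i; rewrite /near /square; lra.
Qed.

Lemma ladder_descends i j : i <= j <= k -> ((a j).2 <= (a i).2)%R.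
Proof.
case/andP; elim: j => [|j IH].
  by rewrite leqn0 => /eqP -> _; lra.
rewrite leq_eqVlt ltnS => /orP[/eqP ->|le_ij] lt_j; first lra.
have := IH le_ij (ltnW lt_j); have := ladder_step lt_j; lra.
Qed.

Lemma ladder_advance i : i <= k -> ((a 0).1 <= (a i).1 <= (a 0).1 + INR i)%R.
Proof.
elim: i => [|i IH] lt_i; first by rewrite /=; lra.
by have := IH (ltnW lt_i); have := ladder_step lt_i; rewrite S_INR; lra.
Qed.

(** Being far from both rail neighbours of [a i.+1] leaves only the upper right and the lower left
    of it, and [b i.+1] excludes the lower left. *)
Lemma ladder_pendant i l : i.+1 < k ->
  near l (a i.+1) -> far l (a i) -> far l (a i.+2) -> far l (b i.+1) ->
  ((a 0).1 + 1 < l.1 <= (a 0).1 + INR i.+1 + 1 /\ (a i.+2).2 + 1 < l.2 <= (a i.+1).2 + 1)%R.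
Proof.
move=> lt_i nl f1 f2 f3.
have lt_i' := ltnW lt_i.
have := ladder_square lt_i'; have := ladder_square lt_i.
have := ladder_advance lt_i'; have := ladder_advance (ltnW lt_i').
have := a_step lt_i'; have := a_step lt_i; have := rung lt_i'; have := rung (ltnW lt_i').
have := rung lt_i; have := b_step lt_i; have := b_step lt_i'; rewrite S_INR.
move: (INR i) => x.
move: nl f1 f2 f3; rewrite /near /far /square => nl f1 f2 f3 *.
by case: f1 => [?|[?|[?|?]]]; try lra; case: f2 => [?|[?|[?|?]]]; try lra;
   case: f3 => [?|[?|[?|?]]]; lra.
Qed.

End Ladder.

(** The distances [c + INR M - f u] to the closed right end have distinct integer parts below
    [M]. *)
Lemma separated_card (T : finType) (f : T -> R) (c : R) (M : nat) :
  (forall u v, u != v -> (f u + 1 < f v \/ f v + 1 < f u)%R) ->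
  (forall u, (c < f u <= c + INR M)%R) -> #|T| <= M.
Proof.
move=> sep f_in; pose z u := Int_part (c + INR M - f u).
have z_in u : (IZR (z u) <= c + INR M - f u < IZR (z u) + 1)%R.
  by have := base_Int_part (c + INR M - f u); rewrite -/(z u); lra.
have z_ge0 u : (0 <= z u)%Z.
  by apply/Zlt_succ_le/lt_IZR; rewrite succ_IZR; have := z_in u; have := f_in u; lra.
have z_lt u : Z.to_nat (z u) < M.
  suff : (z u < Z.of_nat M)%Z by have := z_ge0 u; lia.
  by apply: lt_IZR; rewrite -INR_IZR_INZ; have := z_in u; have := f_in u; lra.
pose g u := Ordinal (z_lt u).
rewrite -[M]card_ord; apply: (@leq_card _ _ g) => u v [/Z2Nat.inj zuv].
apply/eqP; apply/negPn/negP => /sep; have := z_in u; have := z_in v.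
by rewrite zuv //; lra.
Qed.

(** * The gadget graph *)

Lemma edge_sym k s t : symmetric (edge k s t).
Proof. by move=> u v; rewrite /edge orbC. Qed.

Lemma edge_irr k s t : irreflexive (edge k s t).
Proof.
move=> u; rewrite /edge orbb.
by case: u => [| |[]|x i|x i|x i|i] //=; rewrite ?eqxx /=; lia.
Qed.

Definition embeds (h q : nat) (s t : nat -> bool) (P : vtx -> R * R) : Prop :=
  forall u v, wf h q u -> wf h q v -> u != v ->
    if edge h.*2.+2 s t u v then near (P u) (P v) else far (P u) (P v).

Definition rail0 (x : bool) (i : nat) : vtx := if i is i'.+1 then rail x i' else corner.

(* Exchanges the roles of the descending and the ascending ladder. *)
Definition flip (x : bool) (p : R * R) : R * R := if x then (p.1, - p.2)%R else p.

Lemma near_flip x p q : near (flip x p) (flip x q) <-> near p q.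
Proof. by case: x; rewrite /near /=; lra. Qed.

Lemma far_flip x p q : far (flip x p) (flip x q) <-> far p q.
Proof. by case: x; rewrite /far /=; lra. Qed.

Section Squeeze.

Variables (h q j0 : nat) (s t : nat -> bool) (P : vtx -> R * R).
Hypothesis lt_j0 : j0 < h.
Hypothesis s_j0 : s j0 = false.
Hypothesis t_j0 : t j0 = true.
Hypothesis P_emb : embeds h q s t P.
Hypothesis P_corner : square (P corner) (P (rail false 0)) (P inner) (P (rail true 0)).

Let k := h.*2.+2.

Let nearP u v : wf h q u -> wf h q v -> edge k s t u v -> near (P u) (P v).
Proof.
move=> wu wv uv; have neq_uv : u != v by apply: contraTneq uv => ->; rewrite edge_irr.
by have := P_emb wu wv neq_uv; rewrite uv.
Qed.

Let farP u v : wf h q u -> wf h q v -> u != v -> edge k s t u v = false -> far (P u) (P v).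
Proof. by move=> wu wv neq_uv uv; have := P_emb wu wv neq_uv; rewrite uv. Qed.

Let a x i := flip x (P (rail0 x i)).
Let b x i := flip x (P (outer x i)).

Let k_gt2 : 2 < k.
Proof. by rewrite /k; move: lt_j0; case: h => // h'; rewrite doubleS. Qed.

Let wf_rail0 x i : i <= k -> wf h q (rail0 x i).
Proof. by case: i. Qed.

Let a_step x i : i < k -> near (a x i) (a x i.+1).
Proof.
move=> lt_i; apply/near_flip/nearP; try exact: wf_rail0; first exact/wf_rail0/ltnW.
by case: i lt_i => //= i _; rewrite /edge /= !eqxx.
Qed.

Let b_step x i : i < k -> near (b x i) (b x i.+1).
Proof.
move=> lt_i; apply/near_flip/nearP => //=; first exact: ltnW.
by rewrite /edge /= !eqxx.
Qed.

Let rung x i : i <= k -> near (a x i) (b x i).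
Proof.
move=> le_i; apply/near_flip/nearP => //; first exact: wf_rail0.
by case: i le_i => //= i _; rewrite /edge /= !eqxx.
Qed.

Let diag_ab x i : i < k -> far (a x i) (b x i.+1).
Proof.
move=> lt_i; apply/far_flip/farP => //; first exact/wf_rail0/ltnW.
- by case: i lt_i.
- by case: i lt_i => //= i _; rewrite /edge /=; lia.
Qed.

Let diag_ba x i : i < k -> far (b x i) (a x i.+1).
Proof.
move=> lt_i; apply/far_flip/farP => //; first exact: ltnW.
by rewrite /edge /=; lia.
Qed.

Let b_skip x i : i.+1 < k -> far (b x i) (b x i.+2).
Proof.
move=> lt_i; apply/far_flip/farP => //=; first exact/ltnW/ltnW.
- by apply/eqP => -[]; lia.
- by rewrite /edge /=; lia.
Qed.

Let square0 x : 0 < k -> square (b x 0) (b x 1) (a x 1) (a x 0).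
Proof.
move=> k_gt0.
have sq : square (flip x (P corner)) (flip x (P (rail x 0))) (flip x (P inner))
            (flip x (P (rail (~~ x) 0))).
  by move: P_corner; rewrite /square; case: x => /=; lra.
have near_inner y : near (flip x (P inner)) (flip x (P (rail y 0))) by apply/near_flip/nearP.
have near_corner y : near (flip x (P corner)) (flip x (P (rail y 0))) by apply/near_flip/nearP.
(* The first square of ladder [x] is glued to the edge from [corner] to [rail x 0] of the corner
   square. *)
apply: (square_south sq) => //.
- exact: near_sym.
- exact: near_sym.
- exact: (rung x (leq0n _)).
- exact: (b_step x k_gt0).
- exact/near_sym/(rung x k_gt0).
- exact/far_sym/(diag_ba x k_gt0).
- exact: (diag_ab x k_gt0).
- by apply/far_flip/farP => //; rewrite /edge /=; lia.
Qed.

Let desc x i j : i <= j <= k -> ((a x j).2 <= (a x i).2)%R.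
Proof.
exact: (ladder_descends (a_step x) (b_step x) (rung x) (diag_ab x) (diag_ba x) (b_skip x)
         (square0 x)).
Qed.

Let pendant x i l : i.+1 < k ->
  near l (a x i.+1) -> far l (a x i) -> far l (a x i.+2) -> far l (b x i.+1) ->
  ((a x 0).1 + 1 < l.1 <= (a x 0).1 + INR i.+1 + 1 /\
   (a x i.+2).2 + 1 < l.2 <= (a x i.+1).2 + 1)%R.
Proof.
exact: (ladder_pendant (a_step x) (b_step x) (rung x) (diag_ab x) (diag_ba x) (b_skip x)
         (square0 x)).
Qed.

(** [inner] acts as a leaf at position 1 of both ladders at once. *)
Let inner_pos x :
  ((P corner).1 + 1 < (P inner).1 <= (P corner).1 + 2 /\
   (a x 2).2 + 1 < (flip x (P inner)).2)%R.
Proof.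
have [|||||posX posY] := @pendant x 0 (flip x (P inner)).
- exact: ltnW.
- exact/near_flip/nearP.
- by apply/far_flip/farP => //.
- by apply/far_flip/farP => //=.
- by apply/far_flip/farP => //=.
by move: posX posY; rewrite /a; case: (x) => /=; lra.
Qed.

Let leaf_pos x j : j <= j0 ->
  ((P corner).1 + 1 < (P (leaf x j)).1 <= (P corner).1 + INR j0.*2.+2 + 1 /\
   (a x k).2 + 1 < (flip x (P (leaf x j))).2 <= (a x 2).2 + 1)%R.
Proof.
move=> le_j; have wfl : wf h q (leaf x j) by apply: leq_ltn_trans lt_j0.
have [i iE] : exists i, leaf_index s t x j = i.+2.
  by exists (leaf_index s t x j).-2; rewrite /leaf_index; lia.
(* Leaves of earlier letters hang at positions up to [2 j0 + 1]; both leaves of letter [j0] hang at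
   [2 j0 + 2]. *)
have le_i : i <= j0.*2.
  move: iE; rewrite /leaf_index; move: le_j; rewrite leq_eqVlt => /orP[/eqP->|lt_j].
    by rewrite s_j0 t_j0; case: x {wfl} => /=; lia.
  by case: x {wfl} => /=; case: (s j); case: (t j) => /=; lia.
have lt_ik : i.+2 < k by rewrite /k; move: lt_j0 le_i; lia.
have [|||||posX posY] := @pendant x i.+1 (flip x (P (leaf x j))).
- exact: lt_ik.
- by apply/near_flip/nearP; rewrite ?wf_rail0 ?(ltnW lt_ik) //= /edge /= iE !eqxx.
- by apply/far_flip/farP; rewrite ?wf_rail0 ?(ltnW (ltnW lt_ik)) //= /edge /= iE; lia.
- by apply/far_flip/farP; rewrite ?wf_rail0 //= /edge /= iE; lia.
- by apply/far_flip/farP => //; apply: ltnW.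
have le_r : (INR i.+2 <= INR j0.*2.+2)%R by apply: le_INR; lia.
have d1 := @desc x 2 i.+2 (ltnW lt_ik).
have d2 : ((a x k).2 <= (a x i.+3).2)%R by apply: desc; rewrite lt_ik leqnn.
move: (INR i.+2) (INR j0.*2.+2) posX le_r => r1 r2 posX le_r.
move: d1 d2 posX posY; rewrite /a [rail0 x 0]/=; case: (x) => /=; lra.
Qed.

(** The path through the tips has three edges, and [flip] turns the difference of heights into a
    sum. *)
Let tips : ((a true k).2 + (a false k).2 >= -3)%R.
Proof.
have near_tip x : near (P (rail x h.*2.+1)) (P (tip x)).
  by apply: nearP; rewrite /= ?ltnSn // /edge /= !eqxx.
have : near (P (tip false)) (P (tip true)) by apply: nearP.
by move: (near_tip true) (near_tip false); rewrite /near /a /=; lra.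
Qed.

(* The word with letter 0 at [j0] hangs a leaf from position [2 j0 + 2] on the side [false], the
   one with letter 1 does so on the side [true]; with [inner] this makes [2 j0 + 3] leaves at
   positions up to [2 j0 + 2]. *)
Lemma squeeze_false : False.
Proof.
pose T := option (bool * 'I_j0.+1).
pose w (z : T) : vtx := if z is Some y then leaf y.1 y.2 else inner.
have w_inj : injective w by move=> [[x i]|] [[y j]|] //= [-> /val_inj ->].
have wf_w z : wf h q (w z) by case: z => [[x i]|] //=; apply: leq_trans lt_j0.
have w_far y z : y != z -> far (P (w y)) (P (w z)).
  move=> neq_yz; apply: farP => //; first by rewrite inj_eq.
  by case: y z {neq_yz} => [[x i]|] [[y j]|].
have i0 := inner_pos false; have i1 := inner_pos true; have tipsY := tips.
have le_2k : 2 <= k <= k by rewrite leqnn andbT ltnW.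
have d0 := @desc false 2 k le_2k; have d1 := @desc true 2 k le_2k.
have w_pos z : ((P corner).1 + 1 < (P (w z)).1 <= (P corner).1 + 1 + INR j0.*2.+2)%R.
  case: z => [[x i]|]; rewrite [w _]/=; first by have := @leaf_pos x i (ltn_ord i); lra.
  by have := pos_INR j0.*2.+1; rewrite [INR j0.*2.+2]S_INR; lra.
have /(@separated_card _ (fun z => (P (w z)).1)) /(_ w_pos) :
    forall y z, y != z -> ((P (w y)).1 + 1 < (P (w z)).1 \/ (P (w z)).1 + 1 < (P (w y)).1)%R.
  (* [inner] lies above the leaves of side [false] and below those of side [true]. All lie strictly
     between the heights [(a false k).2 + 1] and [- (a true k).2 - 1], at most 1 apart by [tips], so
     they are separated horizontally. *)
  move=> y z neq_yz; move: (w_far _ _ neq_yz); clear w_far.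
  have leafY x (i : 'I_j0.+1) := (@leaf_pos x i (ltn_ord i)).2.
  case: y z neq_yz => [[[] i]|] [[[] j]|] neq_yz; rewrite /w /= /far.
  - by have := leafY true i; have := leafY true j; move: i0 i1 d0 d1 tipsY; rewrite /a /=; lra.
  - by have := leafY true i; have := leafY false j; move: i0 i1 d0 d1 tipsY; rewrite /a /=; lra.
  - by have := leafY true i; move: i0 i1 d0 d1 tipsY; rewrite /a /=; lra.
  - by have := leafY false i; have := leafY true j; move: i0 i1 d0 d1 tipsY; rewrite /a /=; lra.
  - by have := leafY false i; have := leafY false j; move: i0 i1 d0 d1 tipsY; rewrite /a /=; lra.
  - by have := leafY false i; move: i0 i1 d0 d1 tipsY; rewrite /a /=; lra.
  - by have := leafY true j; move: i0 i1 d0 d1 tipsY; rewrite /a /=; lra.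
  - by have := leafY false j; move: i0 i1 d0 d1 tipsY; rewrite /a /=; lra.
  - by rewrite eqxx in neq_yz.
by rewrite card_option card_prod card_bool card_ord; lia.
Qed.

End Squeeze.

Lemma embeds_comp h q s t P (f : R * R -> R * R) :
  (forall u v, near (f u) (f v) <-> near u v) -> embeds h q s t P -> embeds h q s t (f \o P).
Proof.
move=> near_f P_emb u v wu wv neq_uv; have := P_emb u v wu wv neq_uv.
by case: edge => /=; rewrite -?not_nearP near_f.
Qed.

(** The corner 4-cycle has eight possible orientations, and the eight symmetries of the square bring
    each to the one treated above. *)
Lemma mixed_not_embeds h q j0 s t P : j0 < h ->
  s j0 = false -> t j0 = true -> ~ embeds h q s t P.
Proof.
move=> lt_j0 s_j0 t_j0 P_emb.
have impossible f : (forall u v, near (f u) (f v) <-> near u v) ->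
    ~ square (f (P corner)) (f (P (rail false 0))) (f (P inner)) (f (P (rail true 0))).
  move=> near_f; exact: (squeeze_false lt_j0 s_j0 t_j0 (embeds_comp near_f P_emb)).
have fold := square_fold (P_emb corner (rail false 0) isT isT isT)
  (P_emb (rail false 0) inner isT isT isT) (P_emb inner (rail true 0) isT isT isT)
  (P_emb (rail true 0) corner isT isT isT) (P_emb corner inner isT isT isT)
  (P_emb (rail false 0) (rail true 0) isT isT isT).
case: fold => -[] sq.
- by apply: (impossible id).
- by apply: (impossible (fun p => (p.1, - p.2)%R)) => [u v|]; move: sq; rewrite /near /square /=; lra.
- by apply: (impossible (fun p => (- p.1, p.2)%R)) => [u v|]; move: sq; rewrite /near /square /=; lra.
- by apply: (impossible (fun p => (- p.1, - p.2)%R)) => [u v|]; move: sq; rewrite /near /square /=; lra.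
- by apply: (impossible (fun p => (p.2, p.1)%R)) => [u v|]; move: sq; rewrite /near /square /=; lra.
- by apply: (impossible (fun p => (- p.2, p.1)%R)) => [u v|]; move: sq; rewrite /near /square /=; lra.
- by apply: (impossible (fun p => (p.2, - p.1)%R)) => [u v|]; move: sq; rewrite /near /square /=; lra.
- by apply: (impossible (fun p => (- p.2, - p.1)%R)) => [u v|]; move: sq; rewrite /near /square /=; lra.
Qed.

(** * Cut and colouring of the gadget *)

(** The ends of the four edges between the sides, where [corner], [inner] and the tail count as
    lower. *)
Definition in_cut (u : vtx) : bool :=
  u \in [:: corner; inner; tip false; tip true; rail true 0; outer true 0].

Definition upper (u : vtx) : bool :=
  match u with tip x | rail x _ | outer x _ | leaf x _ => x | _ => false end.

Lemma edge_cut k s t u v : upper u != upper v -> edge k s t u v -> in_cut v.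
Proof.
rewrite /edge.
by case: u => [| |[]|[] i|[] i|[] i|i]; case: v => [| |[]|[] [|j]|[] [|j]|[] j|j].
Qed.

(** Words only affect leaf positions: the first word on side [false], the second on side [true]. *)
Lemma edge_lower k s t t' u v : ~~ upper u -> edge k s t u v = edge k s t' u v.
Proof.
rewrite /edge /arc /leaf_index.
by case: u => [| |[]|[] i|[] i|[] i|i] //=; case: v => [| |[]|[] j|[] j|[] j|j].
Qed.

Lemma edge_upper k s s' t u v : upper u -> edge k s t u v = edge k s' t u v.
Proof.
rewrite /edge /arc /leaf_index.
by case: u => [| |[]|[] i|[] i|[] i|i] //=; case: v => [| |[]|[] j|[] j|[] j|j].
Qed.

(** A proper 2-colouring up to the edge joining the tips. *)
Definition colour (k : nat) (s t : nat -> bool) (u : vtx) : bool :=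
  match u with
  | rail _ i | outer _ i => ~~ odd i
  | leaf x j => ~~ odd (leaf_index s t x j)
  | tip _ => ~~ odd k
  | tail i => odd i
  | _ => false
  end.

Definition is_tip (u : vtx) : bool := if u is tip _ then true else false.

Lemma edge_colour k s t u v : edge k s t u v ->
  colour k s t u != colour k s t v \/ is_tip u && is_tip v.
Proof.
suff arcP x y : arc k s t x y -> colour k s t x != colour k s t y \/ is_tip x && is_tip y.
  by case/orP => /arcP[]; [left | right | rewrite eq_sym; left | rewrite andbC; right].
case: x => [| |x|x i|x i|x i|i]; case: y => [| |y|y j|y j|y j|j] //; rewrite /arc /colour; try (by right).
all: try (by move=> /eqP ->; left).
all: try (by case/andP=> _ /eqP ->; left; rewrite /=; case: odd).
all: try (by case/and3P=> _ /eqP -> /eqP ->; left).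
by move=> /eqP ->; left; rewrite /=; case: odd.
Qed.

(** A triangle has a monochromatic edge, which must join the tips, and these have no common
    neighbour. *)
Lemma edge_triangle_free k s t u v w :
  ~ [/\ edge k s t u v, edge k s t v w & edge k s t u w].
Proof.
have no_tips x y z : is_tip x && is_tip y -> edge k s t x y -> edge k s t x z -> ~ edge k s t y z.
  by case: x => // -[]; case: y => // -[]; case: z => [| |[]|[] i|[] i|[] i|i].
case=> uv vw uw.
have [uvc|tips] := edge_colour uv; last exact: (no_tips _ _ _ tips uv uw).
have [vwc|tips] := edge_colour vw.
  have [|tips] := edge_colour uw; first by move: uvc vwc; do 3 case: colour.
  by apply: (no_tips _ _ _ tips uw uv); rewrite edge_sym.
by apply: (no_tips v w u tips vw); rewrite edge_sym.
Qed.

(** * The gadget as a graph on n vertices *)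

Section Enumerated.

Variables (h q n : nat) (e : 'I_n -> vtx).
Hypothesis e_inj : injective e.
Hypothesis e_wf : forall u, wf h q u <-> exists i, e i = u.

Let k := h.*2.+2.

Definition gadget (s t : nat -> bool) : rel 'I_n := fun i j => edge k s t (e i) (e j).

Let wf_e i : wf h q (e i).
Proof. by apply/e_wf; exists i. Qed.

Lemma gadget_connected s t : simple_connected (gadget s t).
Proof.
have symG : symmetric (gadget s t) by move=> i j; rewrite /gadget edge_sym.
split=> //; split=> [i|]; first by rewrite /gadget edge_irr.
have [c cE] : exists c, e c = corner by apply/e_wf.
pose reach u := forall i, e i = u -> connect (gadget s t) c i.
have step u v : wf h q u -> edge k s t u v -> reach u -> reach v.
  move=> /e_wf[i iE] uv ru j jE; apply: connect_trans (ru i iE) (connect1 _).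
  by rewrite /gadget iE jE.
have r0 : reach corner by move=> i iE; rewrite (e_inj (etrans cE (esym iE))).
have r_rail x i : i < k -> reach (rail x i).
  elim: i => [|i IH] lt_i; first exact: (step corner).
  by apply: (step (rail x i)); [exact: ltnW | rewrite /edge /= !eqxx | exact/IH/ltnW].
have r_outer x i : i <= k -> reach (outer x i).
  elim: i => [|i IH] lt_i; first exact: (step corner).
  by apply: (step (outer x i)); [exact: ltnW | rewrite /edge /= !eqxx | exact/IH/ltnW].
have r_tail i : i < q -> reach (tail i).
  elim: i => [|i IH] lt_i; first by apply: (step (outer false 0)) => //; exact: r_outer.
  by apply: (step (tail i)); [exact: ltnW | rewrite /edge /= !eqxx | exact/IH/ltnW].
have r_all u : wf h q u -> reach u.
  case: u => [| |x|x i|x i|x j|i] //= wu; try by auto.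
  - by apply: (step (rail false 0)) => //; exact: r_rail.
  - by apply: (step (rail x h.*2.+1)); rewrite //= ?ltnSn // /edge /= ?eqxx //; exact: r_rail.
  - have /andP[] := leaf_index_bounds s t x wu; case E: (leaf_index s t x j) => [|i] // _ le_i.
    apply: (step (rail x i)); rewrite /= /edge /= ?E ?eqxx //; first exact: ltnW.
    by apply: r_rail; exact: ltnW.
move=> i j; apply: (@connect_trans _ _ c); last exact: (r_all (e j)).
by rewrite (sym_connect_sym symG); exact: (r_all (e i)).
Qed.

Lemma gadget_triangle_free s t : triangle_free (gadget s t).
Proof. by move=> u v w [uv [vw uw]]; apply: (@edge_triangle_free k s t (e u) (e v) (e w)). Qed.

Lemma gadget_unit_square s : unit_square (gadget s s).
Proof.
(* Dividing the integer drawing by its threshold [K] makes the threshold 1. *)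
pose K := (2 * Z.of_nat k)%Z; have K_gt0 : (0 < IZR K)%R by apply: IZR_lt; lia.
pose p i := pos (Z.of_nat k) s (e i).
have frac x : (IZR x = IZR x / IZR K * IZR K)%R by field; lra.
have le_frac x y : (IZR x / IZR K - 1 <= IZR y / IZR K)%R <-> (x - K <= y)%Z.
  transitivity (IZR x - IZR K <= IZR y)%R; last first.
    by rewrite -minus_IZR; split; [apply: le_IZR | apply: IZR_le].
  move: (IZR x / IZR K)%R (IZR y / IZR K)%R (frac x) (frac y) => X Y -> ->.
  by split=> ?; nra.
exists (fun i => (IZR (p i).1 / IZR K, IZR (p i).2 / IZR K)%R); split=> [i j|i j neq_ij].
  case=> /Rmult_eq_reg_r ex /Rmult_eq_reg_r ey; apply: e_inj; apply/eqP/negPn/negP => neq.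
  have [_] := pos_edge s (erefl _) (wf_e i) (wf_e j) neq; apply.
  by split; apply: eq_IZR; [apply: ex | apply: ey]; apply: Rinv_neq_0_compat; lra.
have neq : e i != e j by rewrite inj_eq.
rewrite Rmax_leP !Rabs_le1P /= !le_frac /gadget.
have [-> _] := pos_edge s (erefl _) (wf_e i) (wf_e j) neq.
by rewrite -/K -/(p i) -/(p j); lia.
Qed.

Lemma gadget_mixed s t j0 : j0 < h ->
  s j0 = false -> t j0 = true -> ~ unit_square (gadget s t).
Proof.
move=> lt_j0 s_j0 t_j0 [p [_ pE]].
pose P u := if [pick i | e i == u] is Some i then p i else (0, 0)%R.
have PE i : P (e i) = p i.
  rewrite /P; case: pickP => [j /eqP /e_inj -> //|/(_ i)]; by rewrite eqxx.
apply: (@mixed_not_embeds h q j0 s t P) => // _ _ /e_wf[i <-] /e_wf[j <-].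
rewrite inj_eq // !PE => /pE; rewrite Rmax_leP !Rabs_le1P /gadget /k.
by case: edge => [[H _]|[_ H]]; [apply: H | apply/not_nearP => /H].
Qed.

End Enumerated.

(** The count is 4 special vertices, [2 (2h + 2)] on the rails, [2 (2h + 3)] outer ones, [2h] leaves
    and [q] in the tail. *)
Lemma wf_enumeration h q n : n = 10 * h + 14 + q ->
  exists e : 'I_n -> vtx, injective e /\ forall u, wf h q u <-> exists i, e i = u.
Proof.
move=> nE.
pose F := (option (option bool) + bool * 'I_h.*2.+2 + bool * 'I_h.*2.+3 + bool * 'I_h + 'I_q)%type.
pose f (z : F) : vtx :=
  match z with
  | inl (inl (inl (inl None))) => corner
  | inl (inl (inl (inl (Some None)))) => inner
  | inl (inl (inl (inl (Some (Some x))))) => tip x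
  | inl (inl (inl (inr (x, i)))) => rail x i
  | inl (inl (inr (x, i))) => outer x i
  | inl (inr (x, j)) => leaf x j
  | inr i => tail i
  end.
have f_inj : injective f.
  by do 2 (case=> [[[[[[?|]|]|[? ?]]|[? ?]]|[? ?]]|?]); rewrite /f // => -[];
     first [move=> -> /val_inj -> | move=> /val_inj -> | move=> ->].
have f_wf u : wf h q u <-> exists z, f z = u.
  split=> [|[[[[[[[x|]|]|[x i]]|[x i]]|[x j]]|i] <-] //=]; last by rewrite -ltnS.
  case: u => [| |x|x i|x i|x j|i] /= wu.
  - by exists (inl (inl (inl (inl None)))).
  - by exists (inl (inl (inl (inl (Some None))))).
  - by exists (inl (inl (inl (inl (Some (Some x)))))).
  - by exists (inl (inl (inl (inr (x, Ordinal wu))))).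
  - by rewrite -ltnS in wu; exists (inl (inl (inr (x, Ordinal wu)))).
  - by exists (inl (inr (x, Ordinal wu))).
  - by exists (inr (Ordinal wu)).
have cardF : n = #|{: F}|.
  by rewrite !card_sum !card_prod !card_option !card_bool !card_ord; lia.
exists (fun i => f (enum_val (cast_ord cardF i))); split=> [i j /f_inj/enum_val_inj/cast_ord_inj //|u].
rewrite f_wf; split=> [[z <-]|[i <-]]; last by eexists.
by exists (cast_ord (esym cardF) (enum_rank z)); rewrite cast_ordKV enum_rankK.
Qed.

(** * The linear lower bound *)

Lemma tuple_neq h (s t : h.-tuple bool) : s <> t ->
  exists2 j, j < h & nth false s j <> nth false t j.
Proof.
move=> neq_st; apply: NNPP => all_eq; apply/neq_st/val_inj.
apply: (@eq_from_nth _ false) => [|j lt_j]; first by rewrite !size_tuple.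
by apply: NNPP => neq; apply: all_eq; exists j; rewrite // -(size_tuple s).
Qed.

(** One argument for both classes: gadgets with equal words lie in the smaller class, suitable mixed
    ones outside the larger. *)
Lemma unit_square_lower (cls : forall n, rel 'I_n -> Prop) c : 1 <= c ->
  (forall n (adj : rel 'I_n), tf_usg_class adj -> cls n adj) ->
  (forall n (adj : rel 'I_n), cls n adj -> unit_square adj) ->
  lc_bigOmega cls c id.
Proof.
(* Certificates of at most [n / 120] bits on six cut vertices would give [h <= 6 (n / 120 + 1)],
   about [n / 20], whereas [h] is about [n / 10]; from [n = 200] on this is impossible. *)
move=> c_ge1 sub_cls cls_sub; exists 120, 200; split=> // P V scheme n le_n.
apply: NNPP => none.
pose h := (n - 14) %/ 10; pose q := (n - 14) %% 10.
have nE : n = 10 * h + 14 + q by rewrite /h /q; lia.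
have [e [e_inj e_wf]] := wf_enumeration nE.
pose ids (i : 'I_n) := i.+1.
have ids_ok : valid_ids c ids.
  split=> [i j [] /val_inj //|i]; rewrite Nat_powE /ids /=.
  apply: leq_trans (ltn_ord i) _; rewrite -{1}(expn1 n); apply: leq_pexp2l => //; lia.
pose word (s : h.-tuple bool) j := nth false s j.
pose G s t := gadget h e (word s) (word t).
have G_conn s t : simple_connected (G s t) by exact: gadget_connected e_inj e_wf _ _.
have G_cls s : cls n (G s s).
  apply: sub_cls; split; last exact: gadget_triangle_free.
  exact: gadget_unit_square e_inj e_wf _.
have G_ncls s t : s <> t -> ~ (cls n (G s t) /\ cls n (G t s)).
  move=> /tuple_neq[j lt_j neq_j] [/cls_sub st /cls_sub ts].
  (* Of the two mixed graphs, the one whose first word has letter 0 at [j] cannot be drawn. *)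
  case sj : (nth false s j) neq_j; case tj : (nth false t j) => // _.
    exact: (gadget_mixed e_inj e_wf lt_j tj sj ts).
  exact: (gadget_mixed e_inj e_wf lt_j sj tj st).
have [F FE] : exists F : 'I_6 -> 'I_n, forall i,
    e (F i) = nth corner [:: corner; inner; tip false; tip true; rail true 0; outer true 0] i.
  apply: (@fin_all_exists 'I_6 (fun=> 'I_n) (fun i v => e v = nth corner _ i)) => i.
  by apply/e_wf; case: i => [] [|[|[|[|[|[|[]]]]]]].
have G_cut s t u v : ~~ upper (e u) != ~~ upper (e v) -> G s t u v -> exists i, v = F i.
  rewrite (inj_eq negb_inj) => uv /(edge_cut uv) /(nthP corner)[i lt_i iE].
  by exists (Ordinal lt_i); apply: e_inj; rewrite FE.
have G_left s t t' u v : ~~ upper (e u) -> G s t u v = G s t' u v.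
  exact: edge_lower.
have G_right s s' t u v : ~~ ~~ upper (e u) -> G s t u v = G s' t u v.
  by rewrite negbK; exact: edge_upper.
have size_lt s v : size (P n (G s s) ids v) < (n %/ 120).+1.
  rewrite ltnS leq_divRL // mulnC leqNgt; apply/negP => lt_size.
  by apply: none; exists (G s s), ids, v; split=> //; do 2!split=> //; exact: ltnW.
have := fooling_set G_conn G_cls G_ncls G_left G_right G_cut scheme ids_ok size_lt.
by rewrite card_tuple card_bool leq_exp2l // /h; lia.
Qed.

Theorem theorem6p7 : forall c : nat, 1 <= c ->
  (lc_bigO tf_usg_class c id /\ lc_bigOmega tf_usg_class c id) /\
  (lc_bigOmega usg_class c id /\ lc_bigO usg_class c nlogn).
Proof.
move=> c c_ge1; split; split.
- exact: tf_usg_upper.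
- by apply: unit_square_lower => // n adj [].
- by apply: unit_square_lower => // n adj [].
- exact: usg_upper.
Qed.
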